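(* Let $g$ be a discrete holomorphic function with $|g|\ne1$ at all vertices, and for each admissible $\lambda$ let $\hat n=\hat n^{\lambda}$ be the discrete CMC $1$ surface in $\mathbb{S}^{2,1}$ with Weierstrass-type representation determined by $g$ and $\lambda$ as in the context. Let $p_-,p,p_+$ be three consecutive vertices in one direction (horizontal or vertical) of the lattice such that $\kappa_{p_-p}\cdot\kappa_{pp_+}<0$ for all $\lambda$ sufficiently close to zero (equivalently, exactly one of $|g_{p_-}|^2$ and $|g_{p_+}|^2$ is less than $1$ and the other is greater than $1$). Then for all $\lambda$ sufficiently close to zero, the pair of faces adjacent to the edge $p_-p$ are both singular, or the pair of faces adjacent to the edge $pp_+$ are both singular (including the possibility that all four faces are singular).
   Context: Minkowski space $\mathbb{R}^{3,1}$ (signature $(-,+,+,+)$) is identified with Hermitian $2\times 2$ matrices via $(x_0,x_1,x_2,x_3)\mapsto X=\begin{pmatrix} x_0+x_3 & x_1-ix_2\\ x_1+ix_2 & x_0-x_3\end{pmatrix}$, so $\langle X,X\rangle=-\det X$. $\mathbb{H}^3=\{\langle X,X\rangle=-1\}$, $\mathbb{S}^{2,1}=\{\langle X,X\rangle=1\}$. A quadrilateral (face) of $\mathbb{Z}^2$ has vertices $i=(m,n)$, $j=(m+1,n)$, $k=(m+1,n+1)$, $\ell=(m,n+1)$. For a function $u$ on vertices, $du_{ab}=u_b-u_a$. A discrete holomorphic function is $g:\mathbb{Z}^2\to\mathbb{C}$ with $\frac{(g_i-g_j)(g_k-g_\ell)}{(g_j-g_k)(g_\ell-g_i)}=\frac{\alpha_{ij}}{\alpha_{i\ell}}<0$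 on all quadrilaterals, where the real-valued cross ratio factorizing function $\alpha$ on edges satisfies $\alpha_{ij}=\alpha_{\ell k}$, $\alpha_{i\ell}=\alpha_{jk}$; it is assumed that $dg\ne0$ on all edges. Discrete CMC $1$ surface in $\mathbb{S}^{2,1}$ with Weierstrass-type representation (the case $t=-1$ of the general representation): set $\mathcal{T}_i=1-|g_i|^2\ne0$. A real $\lambda\neq0$ is admissible if $1-\lambda\alpha\ne0$ on all edges. Let $E:\mathbb{Z}^2\to\mathrm{SL}_2\mathbb{C}$ solve $E_i^{-1}E_*=\frac{1}{\sqrt{1-\lambda\alpha_{i*}}}\begin{pmatrix}1&dg_{i*}\\ \lambda\alpha_{i*}/dg_{i*}&1\end{pmatrix}$, $*=j,\ell$, let $L_i=\begin{pmatrix}0&\sqrt{\mathcal{T}_i}\\ -1/\sqrt{\mathcal{T}_i}&\bar g_i/\sqrt{\mathcal{T}_i}\end{pmatrix}$, and $\hat f_i=\mathrm{sgn}(\mathcal{T}_i)E_iL_i\overline{E_iL_i}^{t}\in\mathbb{H}^3$, $\hat n_i=\mathrm{sgn}(\mathcal{T}_i)E_iL_i\begin{pmatrix}1&0\\0&-1\end{pmatrix}\overline{E_iL_i}^{t}\in\mathbb{S}^{2,1}$. The principal curvatures $\kappa_{i*}$ of $\hat n$ on edges are determined by $d\hat f_{i*}=-\kappa_{i*}d\hat n_{i*}$, and are given by $\kappa_{i*}=\dfrac{2|dg_{i*}|^2+(1-|g_i|^2)(1-|g_*|^2)\lambda\alpha_{i*}}{(1-|g_i|^2)(1-|g_*|^2)\lambda\alpha_{i*}}$.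 A quadrilateral of $\hat n$ is singular if it does not lie in a spacelike plane of $\mathbb{R}^{3,1}$, i.e. if $\langle d\hat n_{ij},d\hat n_{ij}\rangle\langle d\hat n_{i\ell},d\hat n_{i\ell}\rangle-\langle d\hat n_{ij},d\hat n_{i\ell}\rangle^2\le0$. ''For all $\lambda$ sufficiently close to zero'' means: there is $\varepsilon>0$ such that the property holds for all admissible $\lambda$ with $0<|\lambda|<\varepsilon$. *)

(* Defs.v *)
From HB Require Import structures.
From mathcomp Require Import all_boot all_order all_algebra.
From mathcomp Require Import reals ring lra.
From mathcomp Require Import complex.

Set Implicit Arguments.
Unset Strict Implicit.
Unset Printing Implicit Defensive.

Import Order.TTheory GRing.Theory Num.Theory.
Local Open Scope ring_scope.
Local Open Scope complex_scope.

(* The lattice Z^2.  An edge is a pair (d, v), joining v to step d v; a face is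
   represented by its lower left vertex i, so that its other vertices are
   j = step Horizontal i, k = step Vertical j and l = step Vertical i. *)
Definition vertex : Type := (int * int)%type.

Inductive direction : Type := Horizontal | Vertical.

Definition transverse (d : direction) : direction :=
  match d with Horizontal => Vertical | Vertical => Horizontal end.

Definition step (d : direction) (v : vertex) : vertex :=
  match d with
  | Horizontal => (v.1 + 1, v.2)
  | Vertical => (v.1, v.2 + 1)
  end.

Definition face_adjacent (q : vertex) (d : direction) (v : vertex) : Prop :=
  q = v \/ step (transverse d) q = v.

Definition diff (V : zmodType) (u : vertex -> V) (d : direction) (v : vertex) : V :=
  u (step d v) - u v.

Section Minkowski.
Variable R : realType.

Definition mx2 (a b c d : R[i]) : 'M[R[i]]_2 :=
  \matrix_(i < 2, j < 2)
    if i == 0 then (if j == 0 then a else b) else (if j == 0 then c else d).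

Definition herm (x : 'rV[R]_4) : 'M[R[i]]_2 :=
  let x0 := x 0 (inord 0) in let x1 := x 0 (inord 1) in
  let x2 := x 0 (inord 2) in let x3 := x 0 (inord 3) in
  mx2 (x0 + x3)%:C (x1 -i* x2) (x1 +i* x2) (x0 - x3)%:C.

Definition adjoint (X : 'M[R[i]]_2) : 'M[R[i]]_2 := (map_mx conjc X)^T.

(* The inverse of [herm] on Hermitian matrices, see [hermK] and [coordsK]. *)
Definition coords (X : 'M[R[i]]_2) : 'rV[R]_4 :=
  \row_(k < 4)
    [:: (complex.Re (X 0 0) + complex.Re (X 1 1)) / 2; complex.Re (X 1 0);
        complex.Im (X 1 0); (complex.Re (X 0 0) - complex.Re (X 1 1)) / 2]`_k.

Definition minkowski (x y : 'rV[R]_4) : R :=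
  - x 0 (inord 0) * y 0 (inord 0) + x 0 (inord 1) * y 0 (inord 1)
  + x 0 (inord 2) * y 0 (inord 2) + x 0 (inord 3) * y 0 (inord 3).

Definition mink (X Y : 'M[R[i]]_2) : R := minkowski (coords X) (coords Y).

Lemma hermK (x : 'rV[R]_4) : coords (herm x) = x.
Proof.
have half (a b : R) : (a + b + (a - b)) / 2 = a by field.
have half' (a b : R) : (a + b - (a - b)) / 2 = b by field.
apply/rowP => k; rewrite !mxE /=.
case: k => [[|[|[|[|//]]]] lt_k] /=; rewrite ?half ?half';
  by congr (x 0 _); apply: val_inj; rewrite /= inordK.
Qed.

Lemma coordsK (X : 'M[R[i]]_2) : adjoint X = X -> herm (coords X) = X.
Proof.
move=> /matrixP hX; have := (hX 0 0, hX 1 1, hX 1 0).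
rewrite !mxE; case E00: (X 0 0) => [a b]; case E01: (X 0 1) => [c e].
case E10: (X 1 0) => [p q]; case E11: (X 1 1) => [u v] /=.
move=> [[[bE] [vE]] [pE qE]].
have b0 : b = 0 by lra.
have v0 : v = 0 by lra.
have o0 (h : (0 < 2)%N) : Ordinal h = 0 by apply: val_inj.
have o1 (h : (1 < 2)%N) : Ordinal h = 1 by apply: val_inj.
apply/matrixP => -[[|[|//]] hi] -[[|[|//]] hj]; rewrite !mxE ?inordK //= ?o0 ?o1;
  rewrite ?E00 ?E01 ?E10 ?E11 ?b0 ?v0 -?pE -?qE /=;
  by apply/eqP; rewrite eq_complex /=; apply/andP; split; apply/eqP; field.
Qed.

Lemma mink_det (x : 'rV[R]_4) : (minkowski x x)%:C = - \det (herm x).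
Proof.
rewrite /minkowski (expand_det_row _ 0) !big_ord_recl big_ord0 /cofactor.
rewrite !det_mx11 !mxE /=; apply/eqP; rewrite eq_complex /=.
by apply/andP; split; apply/eqP; ring.
Qed.

End Minkowski.

Section Weierstrass.
Variable R : realType.
Implicit Types (g : vertex -> R[i]) (alpha : direction -> vertex -> R).
Implicit Types (lam : R) (E X : vertex -> 'M[R[i]]_2).

Definition cross_ratio (a b c d : R[i]) : R[i] :=
  ((a - b) * (c - d)) / ((b - c) * (d - a)).

Definition edge_labelling alpha : Prop :=
  forall i : vertex,
    alpha Horizontal i = alpha Horizontal (step Vertical i) /\
    alpha Vertical i = alpha Vertical (step Horizontal i).

Definition discrete_holomorphic g alpha : Prop :=
  [/\ edge_labelling alpha,
      forall d v, diff g d v != 0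
    & forall i : vertex,
        let j := step Horizontal i in
        let k := step Vertical j in
        let l := step Vertical i in
        cross_ratio (g i) (g j) (g k) (g l)
          = (alpha Horizontal i / alpha Vertical i)%:C /\
        alpha Horizontal i / alpha Vertical i < 0].

Definition admissible alpha lam : Prop :=
  lam != 0 /\ forall d v, 1 - lam * alpha d v != 0.

Definition weierstrass_frame g alpha lam E : Prop :=
  (forall v, \det (E v) = 1) /\
  forall d v,
    invmx (E v) *m E (step d v) =
      (sqrtC (1 - lam * alpha d v)%:C)^-1 *:
        mx2 1 (diff g d v) ((lam * alpha d v)%:C / diff g d v) 1.

Definition Tfun g (v : vertex) : R := 1 - Normc.normc (g v) ^+ 2.

(* The square root is the complex one: it is imaginary where [Tfun g v < 0]. *)
Definition Lmx g (v : vertex) : 'M[R[i]]_2 :=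
  let s := sqrtC (Tfun g v)%:C in mx2 0 s (- s^-1) (conjc (g v) / s).

Definition f_hat g E (v : vertex) : 'M[R[i]]_2 :=
  (Num.sg (Tfun g v))%:C *: ((E v *m Lmx g v) *m adjoint (E v *m Lmx g v)).

Definition n_hat g E (v : vertex) : 'M[R[i]]_2 :=
  (Num.sg (Tfun g v))%:C *:
    ((E v *m Lmx g v) *m mx2 1 0 0 (-1) *m adjoint (E v *m Lmx g v)).

(* [kap] is the principal curvature on the edge (d, v) of the surface n with
   Gauss map f; it is unique, the edge vector of n being nonzero. *)
Definition principal_curvature (f n : vertex -> 'M[R[i]]_2)
    (d : direction) (v : vertex) (kap : R) : Prop :=
  diff n d v != 0 /\ diff f d v = - kap%:C *: diff n d v.

Definition singular_face (n : vertex -> 'M[R[i]]_2) (i : vertex) : Prop :=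
  let a := diff n Horizontal i in
  let b := diff n Vertical i in
  mink a a * mink b b - mink a b ^+ 2 <= 0.

Definition near_zero alpha (P : R -> Prop) : Prop :=
  exists eps : R, 0 < eps /\
    forall lam, admissible alpha lam -> 0 < `|lam| -> `|lam| < eps -> P lam.

End Weierstrass.

(* Main.v *)
Require Import Defs.
From mathcomp Require Import all_boot all_order all_algebra.
From mathcomp Require Import reals complex.
From mathcomp Require Import ring lra.
From mathcomp Require boolp classical_sets cardinality constructive_ereal.
From mathcomp Require measure lebesgue_measure.
Set Implicit Arguments.
Unset Strict Implicit.
Unset Printing Implicit Defensive.

Import Order.TTheory GRing.Theory Num.Theory.
Local Open Scope ring_scope.
Local Open Scope complex_scope.

(** Write T = 1 - |g|^2.  In the frame E_v the point n_v is the Hermitian matrix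
with entries -T_v, -g_v and 1, polynomial in g_v, so that along an edge with
D = g_* - g_v, w = 1 / D and a = lam alpha the edge vector of n is
[a / (1 - a)] times the matrix

  V(w) = [ -T_v,    -T_v conj w            ]
         [ -T_v w,  -1 - 2 Re(g_v w) - a T_* |w|^2 ]

([n_edge_vector], [diff_n_hat]).  The sign conditions of the statement are all
read off from this matrix.

Curvatures.  The edge vector of f is - kappa times that of n with
kappa = 1 + 2 |D|^2 / (T_v T_* a) ([principal_curvatureP]), so that for small
lam the sign of kappa is that of T_v T_* a.  The labels alpha of two
consecutive edges of one direction have the same sign, because both differ in
sign from one and the same transverse label.  Hence kappa_1 kappa_2 has the
sign of T_{p-} T_{p+} ([near_zero_curvature_product]).  To read the sign of
T_{p-} T_{p+} off from a statement about all small admissible lam, one such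
lam must exist: only countably many values are excluded, and an interval is
uncountable ([near_zero_exists]).

Faces.  At a = 0 the matrix V(w) is an affine function of w, and
<V(w), V(w)> = T_v T_* |w|^2.  The inversion D -> 1 / D centred at the vertex i
sends the circle through the four vertices of a face to a line, so 1 / D_k is
a real affine combination of 1 / D_j and 1 / D_l, and V(w_k) the same
combination of V(w_j) and V(w_l) ([cross_ratio_collinear]).  If T_i T_* < 0
for one of the vertices * = j, k, l, the plane of V(w_j) and V(w_l) therefore
contains a timelike vector, and its Gram determinant is negative
([limit_gram_lt0]).  By continuity in lam the face at i is singular for all
small lam ([near_zero_singular_face]).

If T_{p-} T_{p+} < 0, then T changes sign along p- p or along p p+.  Both faces
adjacent to such an edge have T of both signs on their vertices, so one of
their vertices has the sign opposite to that of the base vertex i, and both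
faces are singular ([near_zero_singular_pair]). *)

(** * Hermitian matrices and the Minkowski product *)

Lemma adjointM (R : realType) (A B : 'M[R[i]]_2) :
  adjoint (A *m B) = adjoint B *m adjoint A.
Proof. by rewrite /adjoint map_mxM trmx_mul. Qed.

Lemma adjointD (R : realType) (A B : 'M[R[i]]_2) :
  adjoint (A + B) = adjoint A + adjoint B.
Proof. by apply/matrixP => i j; rewrite !mxE rmorphD. Qed.

Lemma adjointB (R : realType) (A B : 'M[R[i]]_2) :
  adjoint (A - B) = adjoint A - adjoint B.
Proof. by apply/matrixP => i j; rewrite !mxE rmorphB. Qed.

Lemma adjointK (R : realType) (A : 'M[R[i]]_2) : adjoint (adjoint A) = A.
Proof. by apply/matrixP => i j; rewrite !mxE conjcK. Qed.

Lemma adjointZ (R : realType) (c : R[i]) (A : 'M[R[i]]_2) :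
  adjoint (c *: A) = conjc c *: adjoint A.
Proof. by apply/matrixP => i j; rewrite !mxE rmorphM. Qed.

Lemma det_adjoint (R : realType) (A : 'M[R[i]]_2) :
  \det (adjoint A) = conjc (\det A).
Proof. by rewrite /adjoint det_tr det_map_mx. Qed.

Lemma mink_polarization (R : realType) (X Y : 'M[R[i]]_2) :
  mink X Y = (mink (X + Y) (X + Y) - mink (X - Y) (X - Y)) / 4.
Proof.
rewrite /mink /minkowski !mxE !inordK //=.
case: (X 0 0) (X 1 0) (X 1 1) => [a b] [c d] [e f].
case: (Y 0 0) (Y 1 0) (Y 1 1) => [a' b'] [c' d'] [e' f'] /=.
by field.
Qed.

Lemma mink_scale (R : realType) (s s' : R) (X Y : 'M[R[i]]_2) :
  mink (s%:C *: X) (s'%:C *: Y) = s * s' * mink X Y.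
Proof.
rewrite /mink /minkowski !mxE !inordK //=.
case: (X 0 0) (X 1 0) (X 1 1) => [a b] [c d] [e f].
case: (Y 0 0) (Y 1 0) (Y 1 1) => [a' b'] [c' d'] [e' f'] /=.
by field.
Qed.

Lemma mink_sqr (R : realType) (X : 'M[R[i]]_2) :
  adjoint X = X -> (mink X X)%:C = - \det X.
Proof. by move=> hX; rewrite /mink mink_det coordsK. Qed.

(** The action of SL(2, C) on Hermitian matrices is isometric: it preserves the
    determinant, hence the quadratic form, hence its polarization. *)
Lemma mink_congruence (R : realType) (E X Y : 'M[R[i]]_2) :
    \det E = 1 -> adjoint X = X -> adjoint Y = Y ->
  mink (E *m X *m adjoint E) (E *m Y *m adjoint E) = mink X Y.
Proof.
move=> dE hX hY.
have sqr Z : adjoint Z = Z ->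
    mink (E *m Z *m adjoint E) (E *m Z *m adjoint E) = mink Z Z.
  move=> hZ; suff: (mink (E *m Z *m adjoint E) (E *m Z *m adjoint E))%:C =
      (mink Z Z)%:C by case.
  rewrite !mink_sqr //.
    by rewrite !det_mulmx det_adjoint dE rmorph1 mul1r mulr1.
  by rewrite !adjointM adjointK hZ mulmxA.
rewrite mink_polarization [RHS]mink_polarization -!mulmxDl -!mulmxDr -!mulmxBl -!mulmxBr.
by rewrite !sqr // ?adjointB ?adjointD ?hX ?hY.
Qed.

Lemma mulmx2 (R : realType) (a b c d a' b' c' d' : R[i]) :
  mx2 a b c d *m mx2 a' b' c' d' =
  mx2 (a * a' + b * c') (a * b' + b * d') (c * a' + d * c') (c * b' + d * d').
Proof.
apply/matrixP => -[[|[|//]] hi] -[[|[|//]] hj];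
by rewrite !mxE !big_ord_recl big_ord0 !mxE /= addr0.
Qed.

Lemma adjoint_mx2 (R : realType) (a b c d : R[i]) :
  adjoint (mx2 a b c d) = mx2 (conjc a) (conjc c) (conjc b) (conjc d).
Proof. by apply/matrixP => -[[|[|//]] hi] -[[|[|//]] hj]; rewrite !mxE. Qed.

Lemma scale_mx2 (R : realType) (s a b c d : R[i]) :
  s *: mx2 a b c d = mx2 (s * a) (s * b) (s * c) (s * d).
Proof. by apply/matrixP => -[[|[|//]] hi] -[[|[|//]] hj]; rewrite !mxE. Qed.

Lemma sub_mx2 (R : realType) (a b c d a' b' c' d' : R[i]) :
  mx2 a b c d - mx2 a' b' c' d' = mx2 (a - a') (b - b') (c - c') (d - d').
Proof. by apply/matrixP => -[[|[|//]] hi] -[[|[|//]] hj]; rewrite !mxE. Qed.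

Definition hmx (R : realType) (p : R) (z : R[i]) (r : R) : 'M[R[i]]_2 :=
  mx2 p%:C z (conjc z) r%:C.

Lemma adjoint_hmx (R : realType) (p r : R) (z : R[i]) :
  adjoint (hmx p z r) = hmx p z r.
Proof. by rewrite adjoint_mx2 conjcK !conjc_real. Qed.

Lemma scale_hmx (R : realType) (s p r : R) (z : R[i]) :
  s%:C *: hmx p z r = hmx (s * p) (s%:C * z) (s * r).
Proof.
rewrite /hmx scale_mx2; congr mx2; rewrite ?rmorphM //=.
by rewrite oppr0.
Qed.

Lemma sub_hmx (R : realType) (p r p' r' : R) (z z' : R[i]) :
  hmx p z r - hmx p' z' r' = hmx (p - p') (z - z') (r - r').
Proof. by rewrite /hmx sub_mx2 !rmorphB. Qed.

Lemma mink_hmx (R : realType) (p p' r r' : R) (z z' : R[i]) :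
  mink (hmx p z r) (hmx p' z' r') =
  complex.Re z * complex.Re z' + complex.Im z * complex.Im z' - (p * r' + p' * r) / 2.
Proof.
rewrite /mink /minkowski !mxE !inordK //=.
case: z z' => [x y] [x' y'] /=; by field.
Qed.

(** * The surface and its Gauss map in the frame *)

Definition sqn (R : realType) (z : R[i]) : R :=
  complex.Re z ^+ 2 + complex.Im z ^+ 2.

Lemma sqn_eq0 (R : realType) (z : R[i]) : (sqn z == 0) = (z == 0).
Proof.
by case: z => x y; rewrite /sqn paddr_eq0 ?sqr_ge0 // !sqrf_eq0 eq_complex.
Qed.

Lemma sqn_ge0 (R : realType) (z : R[i]) : 0 <= sqn z.
Proof. by rewrite addr_ge0 ?sqr_ge0. Qed.

Lemma sqr_normc_sqn (R : realType) (z : R[i]) :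
  Normc.normc z ^+ 2 = sqn z.
Proof. by case: z => x y; rewrite /sqn /= sqr_sqrtr ?addr_ge0 ?sqr_ge0. Qed.

Lemma Tfun_sqn (R : realType) (g : vertex -> R[i]) v : Tfun g v = 1 - sqn (g v).
Proof. by rewrite /Tfun sqr_normc_sqn. Qed.

Lemma Tfun_neq0 (R : realType) (g : vertex -> R[i]) v :
  Normc.normc (g v) != 1 -> Tfun g v != 0.
Proof.
move=> gv1; rewrite /Tfun subr_eq0 eq_sym sqrp_eq1 //.
by case: (g v) => x y /=; exact: sqrtr_ge0.
Qed.

Lemma complex_sqr_normc (R : realType) (g : vertex -> R[i]) v :
  g v * conjc (g v) = 1 - (Tfun g v)%:C.
Proof.
rewrite Tfun_sqn /sqn; case: (g v) => x y; apply/eqP.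
by rewrite eq_complex /=; apply/andP; split; apply/eqP; ring.
Qed.

Lemma sgMsg (R : realType) (c : R) : c != 0 -> (Num.sg c)%:C * (Num.sg c)%:C = 1 :> R[i].
Proof. by move=> c0; rewrite -rmorphM -expr2 sqr_sg c0. Qed.

(** The square root of a nonzero real number is real or purely imaginary.  This
    is what turns the sign factors in front of the surfaces into the uniform
    formulas [n_hatE] and [f_hatE], free of square roots. *)
Lemma conjc_sqrtC (R : realType) (c : R) : c != 0 ->
  conjc (sqrtC c%:C) = (Num.sg c)%:C * sqrtC c%:C.
Proof.
move=> cn0; have := sqrtCK c%:C; case: (sqrtC c%:C) => x y /eqP.
rewrite expr2 eq_complex /= => /andP[/eqP cE /eqP xyE].
have /eqP : x * y = 0 by lra.
rewrite mulf_eq0 => /orP[] /eqP xy0; apply/eqP; rewrite eq_complex /= xy0 in cE *.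
- have -> : Num.sg c = -1.
    by apply: ltr0_sg; rewrite lt_neqAle cn0 -cE mul0r sub0r oppr_le0 -expr2 sqr_ge0.
  by apply/andP; split; apply/eqP; ring.
- have -> : Num.sg c = 1.
    by apply: gtr0_sg; rewrite lt_neqAle eq_sym cn0 -cE mul0r subr0 -expr2 sqr_ge0.
  by apply/andP; split; apply/eqP; ring.
Qed.

Lemma invsqrtC_norm (R : realType) (c : R) : 0 < c ->
  (sqrtC c%:C)^-1 * conjc (sqrtC c%:C)^-1 = (c^-1)%:C.
Proof.
move=> c0; rewrite conjc_inv conjc_sqrtC ?gt_eqF // gtr0_sg // mul1r.
by rewrite -invfM -expr2 sqrtCK fmorphV.
Qed.

Lemma scale_congruence (R : realType) (s : R[i]) (A B X : 'M[R[i]]_2) :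
  A *m (s *: (B *m X *m adjoint B)) *m adjoint A =
  s *: ((A *m B) *m X *m adjoint (A *m B)).
Proof. by rewrite adjointM -scalemxAr -scalemxAl !mulmxA. Qed.

Lemma n_hatE (R : realType) (g : vertex -> R[i]) E v : Tfun g v != 0 ->
  n_hat g E v = E v *m hmx (- Tfun g v) (- g v) 1 *m adjoint (E v).
Proof.
move=> T0; rewrite /n_hat -scale_congruence; congr (_ *m _ *m _).
have s0 : sqrtC (Tfun g v)%:C != 0 by rewrite sqrtC_eq0 fmorph_eq0.
rewrite /Lmx adjoint_mx2 !mulmx2 scale_mx2 /hmx.
have := complex_sqr_normc g v; have := sgMsg T0; have := sqrtCK (Tfun g v)%:C.
rewrite !rmorph0 !rmorphM !rmorphN /= !conjcK !fmorphV /= conjc_sqrtC //.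
set s := sqrtC _ in s0 *; set t := (Tfun g v)%:C; set e := (Num.sg _)%:C.
set z := g v; set w := conjc z => sE eE zwE.
have e0 : e != 0 by rewrite fmorph_eq0 sgr_eq0.
(* Both sides agree modulo [e * e = 1], [s ^+ 2 = t] and [z * w = 1 - t]; in
   this form they agree as rational functions. *)
have -> : mx2 (- t) (- z) (- w) 1%:C =
    mx2 (- (e * e * s ^+ 2)) (- z) (- (e * e * w)) ((1 - z * w) / s ^+ 2).
  rewrite eE sE zwE !mul1r opprB addrC subrK divff // fmorph_eq0 //.
by congr mx2; field; rewrite ?e0 ?s0.
Qed.

Lemma f_hatE (R : realType) (g : vertex -> R[i]) E v : Tfun g v != 0 ->
  f_hat g E v =
  E v *m hmx (Tfun g v) (g v) (2 / Tfun g v - 1) *m adjoint (E v).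
Proof.
move=> T0; rewrite /f_hat -{1}(mulmx1 (E v *m Lmx g v)) -scale_congruence.
congr (_ *m _ *m _).
have s0 : sqrtC (Tfun g v)%:C != 0 by rewrite sqrtC_eq0 fmorph_eq0.
rewrite mulmx1 /Lmx adjoint_mx2 !mulmx2 scale_mx2 /hmx.
have := complex_sqr_normc g v; have := sgMsg T0; have := sqrtCK (Tfun g v)%:C.
rewrite !rmorph0 !rmorphM !rmorphN /= !conjcK !fmorphV /= conjc_sqrtC //.
set s := sqrtC _ in s0 *; set t := (Tfun g v)%:C; set e := (Num.sg _)%:C.
set z := g v; set w := conjc z => sE eE zwE.
have e0 : e != 0 by rewrite fmorph_eq0 sgr_eq0.
have -> : mx2 t z w (2 / Tfun g v - 1)%:C =
    mx2 (e * e * s ^+ 2) z (e * e * w) ((1 + z * w) / s ^+ 2).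
  rewrite eE sE zwE !mul1r; congr mx2.
  rewrite rmorphB rmorphM fmorphV /= -/t; field.
  by rewrite fmorph_eq0.
by congr mx2; field; rewrite ?e0 ?s0.
Qed.

(** * Edge vectors and principal curvatures *)

(** The edge vector of the surface n at a vertex with value [z] of g, along an
    edge with [1 / dg = w], up to a scalar and in the frame.  For [c = 0] it is affine in [w]; the
    dependence on the parameter of the surface is confined to [c]. *)
Definition edge_mx (R : realType) (z w : R[i]) (c : R) : 'M[R[i]]_2 :=
  hmx (sqn z - 1) ((sqn z - 1)%:C * conjc w) (- 1 - 2 * complex.Re (z * w) - c).

Lemma weierstrass_congruence (R : realType) (D z : R[i]) (a p r : R) :
  let A := mx2 1 D (a%:C / D) 1 in D != 0 ->
  A *m hmx p z r *m adjoint A =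
  hmx (p + 2 * complex.Re (conjc D * z) + sqn D * r)
      (a%:C / conjc D * (p%:C + conjc z * D) + z + r%:C * D)
      (a ^+ 2 / sqn D * p + 2 * a * complex.Re (z / D) + r).
Proof.
move=> A; rewrite -sqn_eq0 /sqn => D0; rewrite /A adjoint_mx2 !mulmx2 /hmx.
case: D D0 {A} => dx dy /= D0; case: z => x y /=.
by congr mx2; apply/eqP; rewrite eq_complex /=; apply/andP; split; apply/eqP;
  field; rewrite ?sqrrN.
Qed.

(** The factor [a] splits off the difference because its terms of order zero in
    [a] cancel; what remains depends on [a] in the lower right entry only. *)
Lemma n_edge_vector (R : realType) (z D : R[i]) (a : R) : D != 0 -> 1 - a != 0 ->
  let A := mx2 1 D (a%:C / D) 1 in
  ((1 - a)^-1)%:C *: (A *m hmx (sqn (z + D) - 1) (- (z + D)) 1 *m adjoint A)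
    - hmx (sqn z - 1) (- z) 1 =
  (a / (1 - a))%:C *: edge_mx z D^-1 (a * (1 - sqn (z + D)) * sqn D^-1).
Proof.
move=> D0 a1 A; rewrite weierstrass_congruence // !scale_hmx sub_hmx /edge_mx.
move: D0; rewrite -sqn_eq0 /sqn.
case: D {A} => dx dy; case: z => x y /= D0.
congr hmx; last 1 first.
- by field; rewrite ?D0 ?a1.
- by field; rewrite ?a1.
apply/eqP; rewrite eq_complex /=; apply/andP; split; apply/eqP; field; rewrite ?sqrrN ?D0 ?a1 //.
Qed.

Lemma f_edge_vector (R : realType) (z D : R[i]) (a : R) :
    D != 0 -> 1 - a != 0 -> a != 0 -> 1 - sqn z != 0 -> 1 - sqn (z + D) != 0 ->
  let A := mx2 1 D (a%:C / D) 1 in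
  let T := 1 - sqn z in let T' := 1 - sqn (z + D) in
  ((1 - a)^-1)%:C *: (A *m hmx T' (z + D) (2 / T' - 1) *m adjoint A)
    - hmx T z (2 / T - 1) =
  - (1 + 2 * sqn D / (T * T' * a))%:C *:
  ((a / (1 - a))%:C *: edge_mx z D^-1 (a * (1 - sqn (z + D)) * sqn D^-1)).
Proof.
move=> D0 a1 a0 T0 T'0 A T T'; rewrite -rmorphN.
rewrite weierstrass_congruence // !scale_hmx sub_hmx /edge_mx /T /T' {A T T'}.
move: D0 T0 T'0; rewrite -sqn_eq0 /sqn.
case: D => dx dy; case: z => x y /= D0 T0 T'0.
congr hmx; last 1 first.
- by field; rewrite ?D0 ?a1 ?T0 ?T'0 ?a0.
- by field; rewrite ?D0 ?a1 ?T0 ?T'0 ?a0.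
apply/eqP; rewrite eq_complex /=; apply/andP; split; apply/eqP; field; rewrite ?sqrrN ?D0 ?a1 ?T0 ?T'0 ?a0 //.
Qed.

Lemma weierstrass_step (R : realType) (g : vertex -> R[i]) alpha lam E d v
    (X : 'M[R[i]]_2) :
    weierstrass_frame g alpha lam E -> 0 < 1 - lam * alpha d v ->
  let A := mx2 1 (diff g d v) ((lam * alpha d v)%:C / diff g d v) 1 in
  E (step d v) *m X *m adjoint (E (step d v)) =
  E v *m (((1 - lam * alpha d v)^-1)%:C *: (A *m X *m adjoint A))
    *m adjoint (E v).
Proof.
move=> [detE hE] a1 A; have uE : E v \in unitmx by rewrite unitmxE detE unitr1.
have -> : E (step d v) = E v *m ((sqrtC (1 - lam * alpha d v)%:C)^-1 *: A).
  by rewrite -hE mulKVmx.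
rewrite !adjointM adjointZ -invsqrtC_norm //.
rewrite -!(scalemxAl, scalemxAr) scalerA !mulmxA.
by congr (_ *: _); rewrite mulrC.
Qed.

Lemma diffK (R : realType) (g : vertex -> R[i]) d v :
  g (step d v) = g v + diff g d v.
Proof. by rewrite /diff addrC subrK. Qed.

Definition edge_curvature (R : realType) (g : vertex -> R[i])
    (alpha : direction -> vertex -> R) (lam : R) d v : R :=
  1 + 2 * sqn (diff g d v) / (Tfun g v * Tfun g (step d v) * (lam * alpha d v)).

Section Edge.
Variables (R : realType) (g : vertex -> R[i]).
Variables (alpha : direction -> vertex -> R) (lam : R) (E : vertex -> 'M[R[i]]_2).
Variables (d : direction) (v : vertex).
Hypotheses (hE : weierstrass_frame g alpha lam E) (dg0 : diff g d v != 0).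
Hypotheses (a1 : 0 < 1 - lam * alpha d v) (T0 : Tfun g v != 0).
Hypothesis (T'0 : Tfun g (step d v) != 0).

Let a := lam * alpha d v.

Lemma diff_n_hat : diff (n_hat g E) d v =
  E v *m ((a / (1 - a))%:C *: edge_mx (g v) (diff g d v)^-1
     (lam * (alpha d v * Tfun g (step d v) * sqn (diff g d v)^-1)))
    *m adjoint (E v).
Proof.
rewrite /diff !n_hatE // (weierstrass_step _ hE a1) -mulmxBl -mulmxBr.
congr (_ *m _ *m _); rewrite !mulrA -/(diff g d v) !Tfun_sqn !diffK !opprB.
by rewrite n_edge_vector // gt_eqF.
Qed.

Lemma diff_f_hat : lam * alpha d v != 0 ->
  diff (f_hat g E) d v =
  - (edge_curvature g alpha lam d v)%:C *: diff (n_hat g E) d v.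
Proof.
move=> a0; rewrite diff_n_hat [RHS]scalemxAl [in RHS]scalemxAr.
rewrite {1}/diff !f_hatE // (weierstrass_step _ hE a1) -mulmxBl -mulmxBr.
congr (_ *m _ *m _).
rewrite /edge_curvature !mulrA; move: T0 T'0.
rewrite -/(diff g d v) !Tfun_sqn !diffK => T0' T'0'.
by rewrite f_edge_vector ?(gt_eqF a1) ?mulrA.
Qed.

(** The upper left entry of the edge vector in the frame is a nonzero multiple
    of [Tfun g v]. *)
Lemma diff_n_hat_neq0 : lam * alpha d v != 0 -> diff (n_hat g E) d v != 0.
Proof.
move=> a0; rewrite diff_n_hat; apply/eqP.
have uE : E v \in unitmx by rewrite unitmxE hE.1 unitr1.
have uE' : adjoint (E v) \in unitmx.
  by rewrite unitmxE det_adjoint hE.1 rmorph1 unitr1.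
move/(congr1 (fun X => invmx (E v) *m X *m invmx (adjoint (E v)))).
rewrite !mulmxA mulVmx // mul1mx mulmxK // mulmx0 mul0mx => /matrixP /(_ 0 0).
rewrite !mxE /= => /eqP; rewrite !mulf_eq0 !fmorph_eq0 mulf_eq0 invr_eq0.
by rewrite (negPf a0) gt_eqF //= -opprB -Tfun_sqn oppr_eq0 (negPf T0).
Qed.

Lemma principal_curvatureP k : lam * alpha d v != 0 ->
  principal_curvature (f_hat g E) (n_hat g E) d v k <->
  k = edge_curvature g alpha lam d v.
Proof.
move=> a0; have n0 := diff_n_hat_neq0 a0; rewrite /principal_curvature.
split=> [[_]|->]; last by split=> //; exact: diff_f_hat.
rewrite diff_f_hat // => /eqP; rewrite -subr_eq0 -scalerBl scaler_eq0 (negPf n0) orbF.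
by rewrite subr_eq0 eqr_opp => /eqP [].
Qed.

End Edge.

(** * The limiting plane of a face *)

Lemma mink_edge_mx (R : realType) (z w w' : R[i]) (c c' : R) :
  mink (edge_mx z w c) (edge_mx z w' c') =
  mink (edge_mx z w 0) (edge_mx z w' 0) + (sqn z - 1) / 2 * (c + c').
Proof. by rewrite !mink_hmx; field. Qed.

(** Since [edge_mx z w 0] is affine in [w], its square norm is a quadratic
    polynomial along a line of values of [w]. *)
Lemma mink_edge_mx_line (R : realType) (z w w' : R[i]) (m : R) :
  mink (edge_mx z (m%:C * w + (1 - m)%:C * w') 0)
       (edge_mx z (m%:C * w + (1 - m)%:C * w') 0) =
  m ^+ 2 * mink (edge_mx z w 0) (edge_mx z w 0)
  + 2 * m * (1 - m) * mink (edge_mx z w 0) (edge_mx z w' 0)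
  + (1 - m) ^+ 2 * mink (edge_mx z w' 0) (edge_mx z w' 0).
Proof.
rewrite !mink_hmx; case: z w w' => [x y] [a b] [a' b'] /=; by field.
Qed.

(** The causal character of an edge vector: it is timelike exactly when the
    edge joins the inside of the unit circle to its outside. *)
Lemma mink_edge_mx_inv (R : realType) (z D : R[i]) : D != 0 ->
  mink (edge_mx z D^-1 0) (edge_mx z D^-1 0) =
  (1 - sqn z) * (1 - sqn (z + D)) / sqn D.
Proof.
rewrite -sqn_eq0 mink_hmx /sqn; case: D z => dx dy [x y] /= D0.
by field; rewrite ?sqrrN.
Qed.

(** The difference of two edge vectors has upper left entry zero, hence it is
    spacelike when [w != w'] and [z] is off the unit circle.  It supplies the
    positive leading coefficient required by [discriminant_lt0]. *)
Lemma mink_edge_mx_chord (R : realType) (z w w' : R[i]) :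
  mink (edge_mx z w 0) (edge_mx z w 0)
  - 2 * mink (edge_mx z w 0) (edge_mx z w' 0)
  + mink (edge_mx z w' 0) (edge_mx z w' 0) = (1 - sqn z) ^+ 2 * sqn (w - w').
Proof.
rewrite !mink_hmx /sqn; case: z w w' => [x y] [a b] [a' b'] /=; by field.
Qed.

(** A quadratic polynomial with positive leading coefficient that takes a
    negative value has a positive discriminant; here it is written in the affine
    basis [m], [1 - m]. *)
Lemma discriminant_lt0 (R : realFieldType) (A B C m : R) :
  0 < A - 2 * B + C ->
  m ^+ 2 * A + 2 * m * (1 - m) * B + (1 - m) ^+ 2 * C < 0 -> A * C - B ^+ 2 < 0.
Proof.
set q := m ^+ 2 * A + _ + _ => lead_gt0 q_lt0.
have -> : A * C - B ^+ 2 =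
    (A - 2 * B + C) * q - (m * (A - 2 * B + C) + B - C) ^+ 2.
  by rewrite /q; ring.
by rewrite subr_lt0 (lt_le_trans _ (sqr_ge0 _)) // pmulr_rlt0.
Qed.

Definition limit_gram (R : realType) (z w w' : R[i]) : R :=
  mink (edge_mx z w 0) (edge_mx z w 0) * mink (edge_mx z w' 0) (edge_mx z w' 0)
  - mink (edge_mx z w 0) (edge_mx z w' 0) ^+ 2.

(** A vector of the affine line through the two edge vectors is timelike, so
    the plane they span is not spacelike. *)
Lemma limit_gram_lt0 (R : realType) (z D w w' : R[i]) (m : R) :
    w != w' -> D != 0 -> D^-1 = m%:C * w + (1 - m)%:C * w' ->
    (1 - sqn z) * (1 - sqn (z + D)) < 0 ->
  limit_gram z w w' < 0.
Proof.
move=> ww' D0 DE opp; apply: (@discriminant_lt0 _ _ _ _ m).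
  rewrite mink_edge_mx_chord mulr_gt0 //.
    rewrite exprn_even_gt0 //=; apply: contraTneq opp => ->.
    by rewrite mul0r ltxx.
  by rewrite lt_neqAle sqn_ge0 eq_sym sqn_eq0 subr_eq0 ww'.
rewrite -mink_edge_mx_line -DE mink_edge_mx_inv //.
by rewrite pmulr_llt0 // invr_gt0 lt_neqAle sqn_ge0 eq_sym sqn_eq0 D0.
Qed.

(** A real cross ratio means that the four points lie on a circle, which the
    inversion at [a] maps to a line.  Negativity excludes the degenerate case
    [c = a], where the cross ratio is 1. *)
Lemma cross_ratio_collinear (R : realType) (a b c d : R[i]) (r : R) :
    b - a != 0 -> d - a != 0 -> c - b != 0 -> r < 0 ->
    cross_ratio a b c d = r%:C ->
  [/\ c - a != 0, (b - a)^-1 != (d - a)^-1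
    & exists m, (c - a)^-1 = m%:C * (b - a)^-1 + (1 - m)%:C * (d - a)^-1].
Proof.
move=> ab ad bc r0 cr.
have r1 : 1 - r%:C != 0 :> R[i].
  by rewrite -(rmorph1 (real_complex R)) -rmorphB fmorph_eq0 gt_eqF // subr_gt0 (lt_trans r0).
have crE : (b - a) * ((c - a) - (d - a)) =
    r%:C * (((c - a) - (b - a)) * (d - a)).
  have den0 : (b - c) * (d - a) != 0 by rewrite mulf_neq0 // -opprB oppr_eq0.
  have num : (a - b) * (c - d) = r%:C * ((b - c) * (d - a)).
    by rewrite -cr /cross_ratio divfK.
  have -> : (b - a) * ((c - a) - (d - a)) = - ((a - b) * (c - d)) by ring.
  by rewrite num; ring.
have : c - b = (c - a) - (b - a) by ring.
move: ab ad bc crE; set x := b - a; set y := d - a; set w := c - a.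
move=> x0 y0 bc0 crE bcE; rewrite bcE in bc0.
have wE : w * (x - r%:C * y) = x * y * (1 - r%:C).
  have -> : w * (x - r%:C * y) = x * (w - y) - r%:C * ((w - x) * y) +
    x * y * (1 - r%:C) by ring.
  by rewrite crE subrr add0r.
have : x * y * (1 - r%:C) != 0 by rewrite !mulf_neq0.
(* [wE] gives [c != a] and that the denominator used below is nonzero. *)
rewrite -wE mulf_eq0 negb_or => /andP[w0 xy0].
split=> //.
  apply/eqP => /invr_inj yx; have : x * (w - x) * (1 - r%:C) != 0 by rewrite !mulf_neq0.
  have -> : x * (w - x) * (1 - r%:C) = x * (w - x) - r%:C * ((w - x) * x) by ring.
  by rewrite {2}yx crE -yx subrr eqxx.
exists (- r / (1 - r)).
have -> : 1 - - r / (1 - r) = (1 - r)^-1.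
  by field; rewrite gt_eqF // subr_gt0 (lt_trans r0).
rewrite rmorphM rmorphN !fmorphV !rmorphB !rmorph1 /=.
have -> : - r%:C / (1 - r%:C) * x^-1 + (1 - r%:C)^-1 * y^-1 =
    (x - r%:C * y) / (x * y * (1 - r%:C)).
  by field; rewrite x0 y0 r1.
by rewrite -wE invfM mulrCA divff // mulr1.
Qed.

(** * Parameters close to zero *)

Section Near.
Variables (R : realType) (alpha : direction -> vertex -> R).
Implicit Types P Q : R -> Prop.

Lemma near_zero_and P Q :
  near_zero alpha P -> near_zero alpha Q -> near_zero alpha (fun x => P x /\ Q x).
Proof.
move=> [e [e0 eP]] [e' [e'0 eQ]]; exists (Num.min e e'); rewrite lt_min e0 e'0.
split=> // lam adm lam0; rewrite lt_min => /andP[le le'].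
by split; [exact: eP | exact: eQ].
Qed.

Lemma near_zero_imply P Q :
  (forall lam, admissible alpha lam -> P lam -> Q lam) ->
  near_zero alpha P -> near_zero alpha Q.
Proof. by move=> PQ [e [e0 eP]]; exists e; split=> // lam ? ? ?; apply/PQ/eP. Qed.

Lemma near_zero_small (c e : R) : 0 < e -> near_zero alpha (fun lam => `|lam * c| < e).
Proof.
move=> e0; have c1 : 0 < `|c| + 1 by rewrite ltr_wpDl.
exists (e / (`|c| + 1)); rewrite divr_gt0 //; split=> // lam _ lam0.
rewrite ltr_pdivlMr // normrM; apply: le_lt_trans.
by rewrite ler_pM2l // lerDl.
Qed.

End Near.

Lemma near_zero_sub_gt0 (R : realType) (alpha : direction -> vertex -> R) d v :
  near_zero alpha (fun lam => 0 < 1 - lam * alpha d v).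
Proof.
apply: near_zero_imply (near_zero_small alpha (alpha d v) ltr01) => lam _ small.
by rewrite subr_gt0 (le_lt_trans (ler_norm _)).
Qed.

Section Uncountable.
Import classical_sets cardinality constructive_ereal measure lebesgue_measure.
Local Open Scope classical_set_scope.

Lemma exists_avoiding_countable (R : realType) (T : countType) (c : T -> R) (e : R) :
  0 < e -> exists2 x, 0 < x < e & forall k, x != c k.
Proof.
move=> e0; apply: boolp.contrapT => no.
have sub : `]0, e[ `<=` range c.
  move=> x /= xe; rewrite in_itv /= in xe.
  apply: boolp.contrapT => nx; apply: no; exists x => // k; apply/eqP => xk.
  by apply: nx; exists k.
have : lebesgue_measure (`]0, e[ : set R) = 0%E.
  apply: countable_lebesgue_measure0.
  apply: sub_countable (subset_card_le sub) _.
  apply: sub_countable (card_image_le _ _) _; exact: countableP.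
rewrite lebesgue_measure_itv /= lte_fin e0 sube0 => -[e_eq].
by rewrite e_eq ltxx in e0.
Qed.

End Uncountable.

(** The lattice being infinite, the excluded values [(alpha d v)^-1] may
    accumulate at zero; they are avoided because they are countably many. *)
Lemma exists_small_admissible (R : realType) (alpha : direction -> vertex -> R) e :
  0 < e -> exists2 lam, admissible alpha lam & 0 < `|lam| < e.
Proof.
pose c (k : bool * (int * int)) := (alpha (if k.1 then Horizontal else Vertical) k.2)^-1.
move=> /(exists_avoiding_countable c) [lam /andP[lam0 lame] avoid].
exists lam; last by rewrite gtr0_norm // lam0.
split=> [|d v]; first by rewrite gt_eqF.
apply/eqP => /subr0_eq lam_inv.
have lamE : lam = (alpha d v)^-1.
  have a0 : alpha d v != 0.
    by apply/eqP => a0; move/eqP: lam_inv; rewrite a0 mulr0 oner_eq0.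
  by apply: (mulIf a0); rewrite -lam_inv mulVf.
have /eqP := avoid (if d is Horizontal then true else false, v).
by rewrite lamE /c; case: (d).
Qed.

(** A property that holds for small parameters is not vacuous. *)
Lemma near_zero_exists (R : realType) (alpha : direction -> vertex -> R) P :
  near_zero alpha P -> exists2 lam, admissible alpha lam & P lam.
Proof.
move=> [e [e0 eP]]; have [lam adm /andP[lam0 lame]] := exists_small_admissible alpha e0.
by exists lam => //; exact: eP.
Qed.

(** * Singular faces *)

(** The left hand side is a concave quadratic polynomial in [lam], so it stays
    below its tangent at zero, and only the slope of the tangent has to be
    controlled. *)
Lemma near_zero_gram (R : realType) (alpha : direction -> vertex -> R)
    (A B C p s s' : R) : A * C - B ^+ 2 < 0 ->
  near_zero alpha (fun lam =>
    (A + p / 2 * (lam * s + lam * s)) * (C + p / 2 * (lam * s' + lam * s'))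
    - (B + p / 2 * (lam * s + lam * s')) ^+ 2 <= 0).
Proof.
rewrite -oppr_gt0 => G0.
apply: near_zero_imply (near_zero_small alpha (p * (A * s' + C * s - B * (s + s'))) G0).
move=> lam _ /(le_lt_trans (ler_norm _)) /ltW.
set u := (X in X <= 0); move=> small.
pose slope := p * (A * s' + C * s - B * (s + s')).
have -> : u = A * C - B ^+ 2 + lam * slope - (lam * p * (s - s') / 2) ^+ 2.
  by rewrite /u /slope; field.
rewrite subr_le0 (le_trans _ (sqr_ge0 _)) //; move: small; rewrite -/slope; lra.
Qed.

Lemma mink_edge_congruence (R : realType) (F : 'M[R[i]]_2) (s s' c c' : R)
    (z w w' : R[i]) : \det F = 1 ->
  mink (F *m (s%:C *: edge_mx z w c) *m adjoint F)
       (F *m (s'%:C *: edge_mx z w' c') *m adjoint F) =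
  s * s' * (mink (edge_mx z w 0) (edge_mx z w' 0) + (sqn z - 1) / 2 * (c + c')).
Proof.
move=> dF; rewrite mink_congruence //; last 2 first.
- by rewrite scale_hmx adjoint_hmx.
- by rewrite scale_hmx adjoint_hmx.
by rewrite mink_scale mink_edge_mx.
Qed.

(** The Gram determinant of the edge vectors at [i] is a positive multiple of a
    perturbation of [limit_gram], which is negative whichever of the three other
    vertices [v] is: its inverse edge lies on the line of the other two. *)
Lemma near_zero_singular_face (R : realType) (g : vertex -> R[i]) alpha E
    (i v : vertex) :
    discrete_holomorphic g alpha -> (forall v, Normc.normc (g v) != 1) ->
    (forall lam, admissible alpha lam -> weierstrass_frame g alpha lam (E lam)) ->
    [\/ v = step Horizontal i, v = step Vertical (step Horizontal i)
      | v = step Vertical i] ->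
    Tfun g i * Tfun g v < 0 ->
  near_zero alpha (fun lam => singular_face (n_hat g (E lam)) i).
Proof.
move=> [_ dg0 cr] g1 hE iv opp.
set w := (diff g Horizontal i)^-1; set w' := (diff g Vertical i)^-1.
have gram0 : limit_gram (g i) w w' < 0.
  have [crE r0] := cr i.
  have dgk : g (step Vertical (step Horizontal i)) - g (step Horizontal i) != 0.
    exact: dg0.
  have [k0 ww' [m mE]] :=
    cross_ratio_collinear (dg0 Horizontal i) (dg0 Vertical i) dgk r0 crE.
  rewrite !Tfun_sqn in opp.
  have shift u : 1 - sqn (g u) = 1 - sqn (g i + (g u - g i)).
    by rewrite [g i + _]addrC subrK.
  case: iv opp => -> opp.
  (* The two neighbours of [i] are the points 1 and 0 of the affine line. *)
  - apply: (@limit_gram_lt0 _ _ (diff g Horizontal i) _ _ 1) => //.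
      by rewrite subrr rmorph1 rmorph0 mul1r mul0r addr0.
    by rewrite -shift.
  - apply: (@limit_gram_lt0 _ _ (g (step Vertical (step Horizontal i)) - g i) _ _ m) => //.
    by rewrite -shift.
  - apply: (@limit_gram_lt0 _ _ (diff g Vertical i) _ _ 0) => //.
      by rewrite subr0 rmorph1 rmorph0 mul1r mul0r add0r.
    by rewrite -shift.
have small := near_zero_and (near_zero_sub_gt0 alpha Horizontal i)
  (near_zero_and (near_zero_sub_gt0 alpha Vertical i)
    (near_zero_gram alpha (sqn (g i) - 1)
      (alpha Horizontal i * Tfun g (step Horizontal i) * sqn w)
      (alpha Vertical i * Tfun g (step Vertical i) * sqn w') gram0)).
apply: near_zero_imply small => lam adm [a1 [b1 gram]].
have T0 u : Tfun g u != 0 by exact: Tfun_neq0.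
rewrite /singular_face /= !(diff_n_hat (hE _ adm)) // -/w -/w'.
rewrite !mink_edge_congruence; try exact: (hE _ adm).1.
pose x := lam * alpha Horizontal i / (1 - lam * alpha Horizontal i).
pose y := lam * alpha Vertical i / (1 - lam * alpha Vertical i).
set G := (X in X <= 0) in gram; set K := (X in X <= 0).
have -> : K = (x * y) ^+ 2 * G by rewrite /K /G /x /y; ring.
by rewrite mulr_ge0_le0 // sqr_ge0.
Qed.

(** The edge contains the base vertex of one of its two faces and is opposite to
    it in the other.  In the latter case the base vertex differs in sign of
    [Tfun g] from one of the two ends of the edge. *)
Lemma near_zero_singular_pair (R : realType) (g : vertex -> R[i]) alpha E d v :
    discrete_holomorphic g alpha -> (forall v, Normc.normc (g v) != 1) ->
    (forall lam, admissible alpha lam -> weierstrass_frame g alpha lam (E lam)) ->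
    Tfun g v * Tfun g (step d v) < 0 ->
  near_zero alpha (fun lam =>
    forall q, face_adjacent q d v -> singular_face (n_hat g (E lam)) q).
Proof.
move=> hg g1 hE opp.
have [q0 [vE uniq_q0]] : exists q0, v = step (transverse d) q0 /\
    forall q, step (transverse d) q = v -> q = q0.
  exists (match d with Horizontal => (v.1, v.2 - 1) | Vertical => (v.1 - 1, v.2) end).
  split=> [|q <-]; first by case: (v) => x y; case: (d) => /=; rewrite subrK.
  by case: q => x y; case: (d) => /=; rewrite addrK.
have face i w := near_zero_singular_face (i := i) (v := w) hg g1 hE.
have near_v : near_zero alpha (fun lam => singular_face (n_hat g (E lam)) v).
  by apply: (face v (step d v)) => //; case: (d); [constructor 1 | constructor 3].
have near_q0 : near_zero alpha (fun lam => singular_face (n_hat g (E lam)) q0).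
  have [opp_v|same] := ltP (Tfun g q0 * Tfun g v) 0.
    apply: (face q0 v) => //; rewrite vE.
    by case: (d); [constructor 3 | constructor 1].
  apply: (face q0 (step d v)); first by rewrite vE; case: (d); constructor 2.
  have T0 u : Tfun g u != 0 by exact: Tfun_neq0.
  have : 0 < Tfun g q0 * Tfun g v by rewrite lt_neqAle eq_sym mulf_neq0.
  by move: opp (T0 q0); set x := Tfun g v; set y := Tfun g _; set z := Tfun g _; nra.
apply: near_zero_imply (near_zero_and near_v near_q0) => lam _ [sv sq0] q [->//|].
by move/uniq_q0 ->.
Qed.

(** * Signs of the principal curvatures *)

Lemma alpha_neq0 (R : realType) (g : vertex -> R[i]) alpha d v :
  discrete_holomorphic g alpha -> alpha d v != 0.
Proof.
move=> [_ _ /(_ v)[_]]; case: d; apply: contraTneq => ->.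
  by rewrite mul0r ltxx.
by rewrite invr0 mulr0 ltxx.
Qed.

Lemma div_lt0 (R : realFieldType) (x y : R) : (x / y < 0) = (x * y < 0).
Proof.
have [->|y0] := eqVneq y 0; first by rewrite invr0.
have -> : x * y = x / y * y ^+ 2 by field.
by rewrite [RHS]pmulr_llt0 // exprn_even_gt0.
Qed.

(** Two consecutive edges of one direction are sides of neighbouring faces,
    whose common side carries a label of the sign opposite to both. *)
Lemma alpha_same_sign (R : realType) (g : vertex -> R[i]) alpha d v :
  discrete_holomorphic g alpha -> 0 < alpha d v * alpha d (step d v).
Proof.
move=> [lab _ cr].
have [_] := cr v; have [_] := cr (step d v); have [labH labV] := lab v.
rewrite !div_lt0; case: d => /=; rewrite -?labH -?labV.
  by set x := alpha _ v; set y := alpha _ v; set z := alpha _ _; nra.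
by set x := alpha _ _; set y := alpha _ _; set z := alpha _ _; nra.
Qed.

(** The product is [2 |dg|^2] plus a term linear in [lam]. *)
Lemma near_zero_curvature_sign (R : realType) (g : vertex -> R[i]) alpha d v :
    discrete_holomorphic g alpha -> (forall v, Normc.normc (g v) != 1) ->
  near_zero alpha (fun lam => 0 < edge_curvature g alpha lam d v *
    (Tfun g v * Tfun g (step d v) * (lam * alpha d v))).
Proof.
move=> hg g1; have D0 : 0 < 2 * sqn (diff g d v).
  have [_ dg0 _] := hg.
  by rewrite mulr_gt0 // lt_neqAle sqn_ge0 eq_sym sqn_eq0 dg0.
apply: near_zero_imply
  (near_zero_small alpha (Tfun g v * Tfun g (step d v) * alpha d v) D0).
move=> lam [lam0 _] small; rewrite /edge_curvature mulrDl mul1r divfK; last first.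
  by rewrite !mulf_neq0 ?Tfun_neq0 // (alpha_neq0 _ _ hg).
by move: small; rewrite ltr_norml => /andP[]; lra.
Qed.

Lemma near_zero_curvature_product (R : realType) (g : vertex -> R[i]) alpha d v :
    discrete_holomorphic g alpha -> (forall v, Normc.normc (g v) != 1) ->
  near_zero alpha (fun lam =>
    (edge_curvature g alpha lam d v * edge_curvature g alpha lam d (step d v) < 0)
    = (Tfun g v * Tfun g (step d (step d v)) < 0)).
Proof.
move=> hg g1.
have near_v := near_zero_curvature_sign d v hg g1.
have near_w := near_zero_curvature_sign d (step d v) hg g1.
apply: near_zero_imply (near_zero_and near_v near_w) => lam [lam0 _] [].
have Tw := Tfun_neq0 (g1 (step d v)).
have := alpha_same_sign d v hg.
set k := edge_curvature _ _ _ _ v; set k' := edge_curvature _ _ _ _ _.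
set t := Tfun g v; set t' := Tfun g (step d v) in Tw *.
set t'' := Tfun g _; set a := alpha d v; set a' := alpha d _.
move=> aa ka ka'; have := mulr_gt0 ka ka'.
have -> : k * (t * t' * (lam * a)) * (k' * (t' * t'' * (lam * a'))) =
    (k * k') * (t * t'') * ((t' * lam) ^+ 2 * (a * a')) by ring.
have pos : 0 < (t' * lam) ^+ 2 * (a * a').
  by rewrite mulr_gt0 // exprn_even_gt0 //= mulf_neq0.
rewrite pmulr_lgt0 //.
have [tt|tt|->] := ltgtP (t * t'') 0; last by rewrite mulr0 ltxx.
  by rewrite nmulr_lgt0.
by rewrite pmulr_lgt0 // => /lt_gtF.
Qed.

Lemma opposite_signs (R : realType) (g : vertex -> R[i]) v w :
  Tfun g v * Tfun g w < 0 <->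
  (Normc.normc (g v) ^+ 2 < 1 /\ 1 < Normc.normc (g w) ^+ 2) \/
  (Normc.normc (g w) ^+ 2 < 1 /\ 1 < Normc.normc (g v) ^+ 2).
Proof.
rewrite /Tfun; split=> [|[] [] ? ?]; [|nra|nra].
set x := _ ^+ 2; set y := _ ^+ 2; move=> xy.
have [x1|x1|x1] := ltgtP x 1; [left|right|].
- by split=> //; rewrite ltNge; apply/negP => y1; nra.
- by split=> //; rewrite ltNge; apply/negP => y1; nra.
- by move: xy; rewrite x1 subrr mul0r ltxx.
Qed.

Theorem corollary9p1 (R : realType) (g : vertex -> R[i])
    (alpha : direction -> vertex -> R)
    (hg : discrete_holomorphic g alpha)
    (hg1 : forall v, Normc.normc (g v) != 1)
    (E : R -> vertex -> 'M[R[i]]_2)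
    (hE : forall lam, admissible alpha lam ->
       weierstrass_frame g alpha lam (E lam))
    (d : direction) (pm p pp : vertex)
    (hp : p = step d pm) (hpp : pp = step d p) :
  let f lam := f_hat g (E lam) in
  let n lam := n_hat g (E lam) in
  let sign_change := near_zero alpha (fun lam =>
    exists k1 k2 : R,
      [/\ principal_curvature (f lam) (n lam) d pm k1,
          principal_curvature (f lam) (n lam) d p k2
        & k1 * k2 < 0]) in
  (sign_change <->
     (Normc.normc (g pm) ^+ 2 < 1 /\ 1 < Normc.normc (g pp) ^+ 2) \/
     (Normc.normc (g pp) ^+ 2 < 1 /\ 1 < Normc.normc (g pm) ^+ 2)) /\
  (sign_change ->
   near_zero alpha (fun lam =>
     (forall q, face_adjacent q d pm -> singular_face (n lam) q) \/
     (forall q, face_adjacent q d p -> singular_face (n lam) q))).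
Proof.
subst p pp => f n sign_change.
have T0 v : Tfun g v != 0 by exact: Tfun_neq0.
have frames : near_zero alpha (fun lam => (0 < 1 - lam * alpha d pm) /\
    (0 < 1 - lam * alpha d (step d pm))).
  by apply: near_zero_and; exact: near_zero_sub_gt0.
have curvature lam v k : admissible alpha lam -> 0 < 1 - lam * alpha d v ->
    principal_curvature (f lam) (n lam) d v k <->
    k = edge_curvature g alpha lam d v.
  move=> adm a1; have [_ dg0 _] := hg.
  apply: (principal_curvatureP (hE _ adm)) => //.
  by rewrite mulf_neq0 ?(alpha_neq0 _ _ hg) //; case: adm.
have near_sign := near_zero_curvature_product d pm hg hg1.
have opposite : sign_change <-> Tfun g pm * Tfun g (step d (step d pm)) < 0.
  split=> [change|opp].
    have [lam adm [[k1 [k2 [k1P k2P k12]]] [<- [a1 a2]]]] :=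
      near_zero_exists (near_zero_and change (near_zero_and near_sign frames)).
    by rewrite -((curvature _ _ _ adm a1).1 k1P) -((curvature _ _ _ adm a2).1 k2P).
  apply: near_zero_imply (near_zero_and near_sign frames) => lam adm [sgn [a1 a2]].
  exists (edge_curvature g alpha lam d pm), (edge_curvature g alpha lam d (step d pm)).
  by split; [exact/curvature | exact/curvature | rewrite sgn].
split; first by rewrite opposite opposite_signs.
move=> /opposite opp.
have [opp_m|same_m] := ltP (Tfun g pm * Tfun g (step d pm)) 0.
  apply: near_zero_imply (near_zero_singular_pair hg hg1 hE opp_m) => lam _.
  by left.
have opp_p : Tfun g (step d pm) * Tfun g (step d (step d pm)) < 0.
  have : 0 < Tfun g pm * Tfun g (step d pm) by rewrite lt_neqAle eq_sym mulf_neq0.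
  move: opp; set x := Tfun g pm; set y := Tfun g _; set z := Tfun g _; nra.
apply: near_zero_imply (near_zero_singular_pair hg hg1 hE opp_p) => lam _.
by right.
Qed.
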